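(* Assume that Assumption A (stated in the context) holds for the prior $\pi(\theta)$ and the true parameter $\theta_{\mathrm{true}}$, and define $$k_\ast = k_\ast(\theta_{\mathrm{true}}) := \frac{\max\left(I_{\theta_{\mathrm{true},0}}^{-1}-\mathbb{E}_{\theta\sim\pi(\theta)}[I_{\theta_0}^{-1}],\,0\right)}{\left(\mathrm{Var}_{\theta\sim\pi(\theta)}(I_{\theta_0}^{-1})\right)^{1/2}}.$$ Then: (1) For any $k>k_\ast$, $$\lim_{n\to\infty}\mathbb{P}_{\mathbf{x}_n\sim p(\mathbf{x}_n|\theta_{\mathrm{true}})}\left(u_n^2>\overline{u_n^2}+k\,\Delta u_n^2\right)=0.$$ (2) In particular, for any $k>k_\ast$, with $n_\varepsilon$ denoting the smallest $n\ge 1$ such that $\overline{u_n^2}+k\,\Delta u_n^2<\varepsilon^2$, $$\lim_{\varepsilon\to 0}\mathbb{P}_{\mathbf{x}_{n_\varepsilon}\sim p(\mathbf{x}_{n_\varepsilon}|\theta_{\mathrm{true}})}\left(u_{n_\varepsilon}^2\ge\varepsilon^2\right)=0.$$ (3) Moreover, for any $k$ with $0<k<k_\ast$, $$\lim_{n\to\infty}\mathbb{P}_{\mathbf{x}_n\sim p(\mathbf{x}_n|\theta_{\mathrm{true}})}\left(u_n^2<\overline{u_n^2}+k\,\Delta u_n^2\right)=0.$$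
   Context: Setting. For each integer $n\ge 1$ the data $\mathbf{x}_n=(x_1,\ldots,x_n)$ have a sampling distribution $p(\mathbf{x}_n|\theta)=p(x_1,\ldots,x_n|\theta)$ depending on a parameter $\theta=(\theta_0,\theta')$, where $\theta_0$ is a univariate (real) parameter of interest and $\theta'$ is a nuisance parameter that may be empty or multivariate. $\pi(\theta)$ is a prior distribution for $\theta$, and $\theta_{\mathrm{true}}=(\theta_{\mathrm{true},0},\theta_{\mathrm{true}}')$ is a fixed value in the domain of $\pi(\theta)$, treated as the true parameter. $I_\theta$ denotes the Fisher information matrix of the single-sample distribution $p(x_1|\theta)$, and $I_{\theta_0}$ denotes its first component, i.e. the diagonal entry of $I_\theta$ linked to $\theta_0$; it is a non-negative number (depending on the whole $\theta$). $I_{\theta_{\mathrm{true},0}}$ denotes this entry at $\theta=\theta_{\mathrm{true}}$. $I_{\theta_0}^{-1}$ and $I_{\theta_{\mathrm{true},0}}^{-1}$ are the reciprocals of these numbers. The posterior is $\pi(\theta|\mathbf{x}_n)\propto\pi(\theta)\,p(\mathbf{x}_n|\theta)$ with marginal $\pi(\theta_0|\mathbf{x}_n)$ for $\theta_0$, and the prior predictive is $m(\mathbf{x}_n)=\int p(\mathbf{x}_n|\theta)\,\pi(\theta)\,\mathrm{d}\theta$. Define $$u_n^2=\mathrm{Var}_{\theta_0\sim\pi(\theta_0|\mathbf{x}_n)}(\theta_0)\ \text{(a function of } \mathbf{x}_n),\quad \overline{u_n^2}=\mathbb{E}_{\mathbf{x}_n\sim m(\mathbf{x}_n)}[u_n^2],\quad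 \Delta u_n^2=\left(\mathrm{Var}_{\mathbf{x}_n\sim m(\mathbf{x}_n)}(u_n^2)\right)^{1/2}.$$ Assumption A (on $\pi(\theta)$ and $\theta_{\mathrm{true}}$): 1. $I_{\theta_0}$ is strictly positive for $\theta=\theta_{\mathrm{true}}$ and for almost every $\theta$ in the domain of $\pi(\theta)$; the second moment $\mathbb{E}_{\theta\sim\pi(\theta)}[I_{\theta_0}^{-2}]$ exists (is finite); and $\mathrm{Var}_{\theta\sim\pi(\theta)}(I_{\theta_0}^{-1})>0$. 2. It holds that $$\lim_{n\to\infty}\mathbb{E}_{\mathbf{x}_n\sim p(\mathbf{x}_n|\theta_{\mathrm{true}})}\left[\left|n\,u_n^2-I_{\theta_{\mathrm{true},0}}^{-1}\right|^2\right]=0\quad\text{and}\quad \lim_{n\to\infty}\mathbb{E}_{\theta\sim\pi(\theta)}\left[\mathbb{E}_{\mathbf{x}_n\sim p(\mathbf{x}_n|\theta)}\left[\left|n\,u_n^2-I_{\theta_0}^{-1}\right|^2\right]\right]=0.$$ 3. For all $n$ we have $\overline{u_n^2}>0$. *)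

(* Defs.v *)
From HB Require Import structures.
From mathcomp Require Import all_boot all_order all_algebra.
From mathcomp Require Import all_classical all_reals all_analysis measurable_realfun.

Set Implicit Arguments.
Unset Strict Implicit.
Unset Printing Implicit Defensive.

Import Order.TTheory GRing.Theory Num.Theory.
Import numFieldNormedType.Exports.

Local Open Scope classical_set_scope.
Local Open Scope ring_scope.

Section density_measure.
Context d (T : measurableType d) (R : realType).
Local Open Scope ereal_scope.

Definition density_measure (mu : {measure set T -> \bar R}) (f : T -> \bar R)
    (mf : measurable_fun setT f) (f0 : forall x, 0 <= f x) : set T -> \bar R :=
  fun A => \int[mu]_(x in A) f x.

Variables (mu : {measure set T -> \bar R}) (f : T -> \bar R).
Variables (mf : measurable_fun setT f) (f0 : forall x, 0 <= f x).

Let nu := density_measure mu mf f0.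

Let nu0 : nu set0 = 0.
Proof. exact: integral_set0. Qed.

Let nu_ge0 A : 0 <= nu A.
Proof. by apply: integral_ge0 => x _; exact: f0. Qed.

Let nu_sigma_additive : semi_sigma_additive nu.
Proof. exact: semi_sigma_additive_nng_induced. Qed.

HB.instance Definition _ :=
  isMeasure.Build _ _ _ (density_measure mu mf f0) nu0 nu_ge0 nu_sigma_additive.

End density_measure.

(* A parameter is theta = (theta_0, theta') with theta' in R^d, d >= 0; it is
   encoded as a (d+1)-tuple whose coordinate ord0 is theta_0. *)
Notation param R d := ((d.+1).-tuple R).

(* A dominated parametric model. The observations x_i live in X; for each n,
   density n theta is the density of x_n = (x_1, ..., x_n) with respect to
   ref n (e.g. a product measure). It only matters for theta in domain. The x_i
   need not be independent. The case n = 0 is a dummy one, ref 0 can be taken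
   to be a Dirac mass. *)
Record model (R : realType) (dX : measure_display) (X : measurableType dX)
    (d : nat) := Model {
  domain : set (param R d) ;
  ref : forall n : nat, {sigma_finite_measure set (n.-tuple X) -> \bar R} ;
  density : forall n : nat, param R d -> n.-tuple X -> R ;
  measurable_domain : measurable domain ;
  measurable_density : forall n,
    measurable_fun (domain `*` [set: n.-tuple X])
      (fun z => density z.1 z.2) ;
  density_ge0 : forall n theta x, domain theta -> 0 <= @density n theta x ;
  density_normalized : forall n theta, domain theta ->
    (\int[ref n]_x (@density n theta x)%:E = 1)%E }.

Arguments density {R dX X d} _ n _ _.

Section model_theory.
Context (R : realType) (dX : measure_display) (X : measurableType dX) (d : nat).
Variable M : model R X d.

Definition likelihood (n : nat) (theta : param R d) (x : n.-tuple X) : \bar R :=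
  if theta \in domain M then (density M n theta x)%:E else 0%E.

Lemma likelihood_ge0 n theta x : (0 <= @likelihood n theta x)%E.
Proof.
rewrite /likelihood; case: ifPn => // /set_mem Dt.
by rewrite lee_fin; exact: density_ge0.
Qed.

Lemma measurable_likelihood n :
  measurable_fun [set: param R d * n.-tuple X]
    (fun z => likelihood z.1 z.2).
Proof.
have -> : (fun z : param R d * n.-tuple X => likelihood z.1 z.2) =
    (EFin \o (fun z => density M n z.1 z.2)) \_
      (domain M `*` [set: n.-tuple X]).
  apply/funext => z; rewrite /patch /likelihood.
  by congr (if _ then _ else _); apply/idP/idP => /set_mem;
    [move=> ?; apply/mem_set; split|move=> [? _]; apply/mem_set].
apply/(measurable_restrictT _ _).1.
  by apply: measurableX => //; exact: measurable_domain.
by apply/measurable_EFinP; exact: measurable_density.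
Qed.

Lemma measurable_likelihood_data n theta :
  measurable_fun setT (@likelihood n theta).
Proof.
exact: (measurable_comp measurableT _ (@measurable_likelihood n)
  (pair1_measurable theta)).
Qed.

Lemma measurable_likelihood_param n (x : n.-tuple X) :
  measurable_fun setT (fun theta => likelihood theta x).
Proof.
exact: (measurable_comp measurableT _ (@measurable_likelihood n)
  (pair2_measurable x)).
Qed.

(* p(x_n | theta) as a measure; it is a probability measure for theta in the
   domain of the model, and the zero measure otherwise. *)
Definition sampling (n : nat) (theta : param R d) :
    {measure set (n.-tuple X) -> \bar R} :=
  density_measure (ref M n) (@measurable_likelihood_data n theta)
    (@likelihood_ge0 n theta).

Definition update (theta : param R d) (i : 'I_d.+1) (t : R) : param R d :=
  [tuple if j == i then t else tnth theta j | j < d.+1].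

Definition score (theta : param R d) (i : 'I_d.+1) (x : 1.-tuple X) : R :=
  derive1 (fun t => ln (density M 1 (update theta i t) x)) (tnth theta i).

(* An entry whose integral is infinite is 0 here (Rintegral); for fisher0 this
   degenerate value is ruled out by the positivity required in assumption_A. *)
Definition fisher (theta : param R d) : 'M[R]_d.+1 :=
  \matrix_(i, j) \int[sampling 1 theta]_x (score theta i x * score theta j x).

Definition fisher0 (theta : param R d) : R := fisher theta ord0 ord0.

(* theta |-> 1 / I_{theta_0} on the domain of the model, extended by 0 to a
   total function. *)
Definition inv_fisher0 : param R d -> R :=
  (fun theta => (fisher0 theta)^-1) \_ (domain M).

Variable prior : probability (param R d) R.

Definition predictive_density (n : nat) (x : n.-tuple X) : \bar R :=
  (\int[prior]_theta likelihood theta x)%E.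

Lemma predictive_density_ge0 n x : (0 <= @predictive_density n x)%E.
Proof. by apply: integral_ge0 => theta _; exact: likelihood_ge0. Qed.

Lemma measurable_predictive_density n :
  measurable_fun setT (@predictive_density n).
Proof.
apply: (@measurable_fun_fubini_tonelli_G _ _ _ _ _ prior
  (fun z => @likelihood n z.1 z.2)).
- exact: measurable_likelihood.
- by move=> z; exact: likelihood_ge0.
Qed.

Definition predictive (n : nat) : {measure set (n.-tuple X) -> \bar R} :=
  density_measure (ref M n) (@measurable_predictive_density n)
    (@predictive_density_ge0 n).

(* When predictive_density x is 0 or +oo Bayes' rule is meaningless and
   mnormalize returns its second argument, here the prior. *)
Definition posterior (n : nat) (x : n.-tuple X) : probability (param R d) R :=
  mnormalize
    (density_measure prior (@measurable_likelihood_param n x)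
      (fun theta => likelihood_ge0 theta x))
    prior.

Definition theta0 (theta : param R d) : R := tnth theta ord0.

Lemma measurable_theta0 : measurable_fun setT theta0.
Proof. exact: measurable_tnth. Qed.

HB.instance Definition _ :=
  isMeasurableFun.Build _ _ _ _ theta0 measurable_theta0.

Definition marginal_posterior (n : nat) (x : n.-tuple X) : probability R R :=
  distribution (posterior x) theta0.

Local Open Scope ereal_scope.

(* u_n^2, its mean and its standard deviation are extended real numbers, since
   a posterior variance (or its mean or variance) may be infinite for small n.
   If mean_u2 n = +oo then sd_u2 n = +oo. *)
Definition u2 (n : nat) (x : n.-tuple X) : \bar R :=
  'V_(marginal_posterior x)[idfun].

Definition mean_u2 (n : nat) : \bar R := \int[predictive n]_x u2 x.

Definition sd_u2 (n : nat) : \bar R :=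
  sqrte (\int[predictive n]_x ((u2 x - mean_u2 n) ^+ 2)).

Definition threshold (k : R) (n : nat) : \bar R := mean_u2 n + k%:E * sd_u2 n.

Definition is_n_eps (k eps : R) (n : nat) : Prop :=
  [/\ (1 <= n)%N,
      threshold k n < (eps ^+ 2)%:E &
      forall m, (1 <= m)%N -> threshold k m < (eps ^+ 2)%:E -> (n <= m)%N].

Definition n_eps (k eps : R) : nat := xget 0%N [set n | is_n_eps k eps n].

Definition k_star (theta_true : param R d) : R :=
  (Num.max ((fisher0 theta_true)^-1 - fine 'E_prior[inv_fisher0]) 0
     / Num.sqrt (fine 'V_prior[inv_fisher0]))%R.

Record assumption_A (theta_true : param R d) : Prop := AssumptionA {
  fisher0_true_gt0 : (0 < fisher0 theta_true)%R ;
  fisher0_gt0 : {ae prior, forall theta, domain M theta -> (0 < fisher0 theta)%R} ;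
  measurable_inv_fisher0 : measurable_fun setT inv_fisher0 ;
  inv_fisher0_moment2 : 'E_prior[inv_fisher0 ^+ 2] < +oo ;
  inv_fisher0_variance : 0 < 'V_prior[inv_fisher0] ;
  cvg_u2_true :
    \int[sampling n theta_true]_x
      (`|n%:R%:E * u2 x - ((fisher0 theta_true)^-1)%:E| ^+ 2)
      @[n --> \oo] --> 0 ;
  cvg_u2_prior :
    \int[prior]_theta \int[sampling n theta]_x
      (`|n%:R%:E * u2 x - (inv_fisher0 theta)%:E| ^+ 2)
      @[n --> \oo] --> 0 ;
  mean_u2_gt0 : forall n : nat, (1 <= n)%N -> 0 < mean_u2 n }.

End model_theory.

(* Main.v *)
Require Import Defs.
From HB Require Import structures.
From mathcomp Require Import all_boot all_order all_algebra.
From mathcomp Require Import all_classical all_reals all_analysis measurable_realfun.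
From mathcomp Require Import lra.

Set Implicit Arguments.
Unset Strict Implicit.
Unset Printing Implicit Defensive.

Import Order.TTheory GRing.Theory Num.Theory.
Import numFieldNormedType.Exports.

Local Open Scope classical_set_scope.
Local Open Scope ring_scope.
Local Open Scope ereal_scope.

(** Write [J] for the reciprocal [1 / I_{theta_0}] as a function of [theta], and
    let [theta] be drawn from the prior and then [x_n] from [p(x_n | theta)].
    Under this joint law [theta] has the prior law and [x_n] the prior
    predictive law ([joint_law]), and the second limit of Assumption A says that
    [n u_n^2 - J] tends to 0 in L2. Mean and standard deviation are 1-Lipschitz
    for the L2 distance ([mean_sd_L2_lipschitz], by the covariance inequality),
    so [n] times the mean and [n] times the standard deviation of [u_n^2] tend
    to the prior mean [mu] and prior standard deviation [sigma > 0] of [J];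
    hence [n] times the threshold tends to [mu + k sigma]
    ([near_scaled_threshold]).

    Under the true parameter [n u_n^2] tends in L2 to [c], the value of
    [1 / I_{theta_0}] there. The number [k_star] is the one for which
    [c < mu + k sigma] when [k > k_star], and [mu + k sigma < c] when
    [0 < k < k_star]. In both cases the limits of [n u_n^2] and of [n] times the
    threshold are separated, and Chebyshev's inequality ([cvg0_deviation]) makes
    the probability of the wrong order vanish: this gives the first and the
    third claim.

    For the second claim, the thresholds tend to 0, so the index [n_eps] exists,
    and they are positive, so [n_eps] tends to infinity as [eps] tends to 0
    ([cvg_n_eps]). As the threshold at [n_eps] is below [eps^2], the event of
    that claim is contained in the event of the first one at [n_eps].

    The computation needs [u_n^2] to be a measurable function of the data: the
    lower integral of a non-measurable function is not additive and Tonelli's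
    theorem fails for it. This follows from Bayes' formula for posterior
    integrals ([measurable_u2]). *)

(** * Integration against a measure with a density *)

Section density_integral.
Context d (T : measurableType d) (R : realType).
Variables (mu : {measure set T -> \bar R}) (f : T -> \bar R).
Variables (mf : measurable_fun setT f) (f0 : forall x, 0 <= f x).

Import HBNNSimple.

Let nu : {measure set T -> \bar R} := density_measure mu mf f0.

Lemma integral_density_measure_indic (A : set T) : measurable A ->
  \int[nu]_x (\1_A x)%:E = \int[mu]_x ((\1_A x)%:E * f x).
Proof.
move=> mA; rewrite integral_indic// setIT [LHS]integral_mkcond.
apply: eq_integral => x _.
by rewrite patchE indicE; case: ifPn => _; rewrite ?mul1e ?mul0e.
Qed.

Lemma integral_density_measure_nnsfun (h : {nnsfun T >-> R}) :
  \int[nu]_x (h x)%:E = \int[mu]_x ((h x)%:E * f x).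
Proof.
under [LHS]eq_integral do rewrite fimfunE -fsumEFin//.
rewrite [LHS]ge0_integral_fsum//; last 2 first.
- by move=> r; exact/measurable_EFinP/measurableT_comp.
- by move=> r x _; rewrite EFinM nnfun_muleindic_ge0.
under [RHS]eq_integral.
  move=> x xD; rewrite fimfunE -fsumEFin// ge0_mule_fsuml; last first.
    by move=> r; rewrite EFinM nnfun_muleindic_ge0.
  over.
rewrite [RHS]ge0_integral_fsum//; last 2 first.
- move=> r; apply: emeasurable_funM => //.
  exact/measurable_EFinP/measurableT_comp.
- by move=> r x _; rewrite mule_ge0// EFinM nnfun_muleindic_ge0.
apply: eq_fsbigr => r /set_mem [x _ rx].
have r0 : (0 <= r)%R by rewrite -rx.
have mr := measurable_funPTI h (measurable_set1 r).
under eq_integral do rewrite EFinM.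
rewrite ge0_integralZl//; [|exact/measurable_EFinP/measurable_indic].
under [RHS]eq_integral do rewrite EFinM -muleA.
rewrite integral_density_measure_indic// ge0_integralZl//.
- by apply: emeasurable_funM => //; exact/measurable_EFinP/measurable_indic.
- by move=> y _; rewrite mule_ge0// lee_fin.
Qed.

(** Monotone convergence transports the defining identity
    [nu A = \int[mu]_(x in A) f x] from indicators to nonnegative functions. *)
Lemma ge0_integral_density_measure (g : T -> \bar R) :
  measurable_fun setT g -> (forall x, 0 <= g x) ->
  \int[nu]_x g x = \int[mu]_x (g x * f x).
Proof.
move=> mg g0; pose h := nnsfun_approx measurableT mg.
have hg x : EFin \o h^~ x @ \oo --> g x.
  exact/cvg_nnsfun_approx.
have ndh x : {homo (fun n => (h n x)%:E) : m n / (m <= n)%N >-> m <= n}.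
  by move=> m n mn; rewrite lee_fin; exact/lefP/nd_nnsfun_approx.
have mh n : measurable_fun setT (EFin \o h n) by exact/measurable_EFinP.
have gE : g = (fun x => limn (fun n => (h n x)%:E)).
  by apply/funext => x; apply/esym/cvg_lim => //; exact: hg.
transitivity (limn (fun n => \int[nu]_x (h n x)%:E)).
  rewrite [in LHS](_ : g = (fun x => limn (fun n => (h n x)%:E))); last first.
    exact: gE.
  by rewrite monotone_convergence// => n x _; rewrite lee_fin.
transitivity (limn (fun n => \int[mu]_x ((h n x)%:E * f x))).
  by under eq_fun do rewrite integral_density_measure_nnsfun.
rewrite -monotone_convergence//.
- apply: eq_integral => x _; apply/cvg_lim => //.
  (* When [f x] or [g x] is 0 the other factor may be infinite, and the limit of
     the products is then not covered by continuity of the product. *)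
  have [fx0|fx0] := eqVneq (f x) 0.
    by rewrite fx0 mule0; under eq_fun do rewrite mule0; exact: cvg_cst.
  have [gx0|gx0] := eqVneq (g x) 0.
    rewrite gx0 mul0e (_ : (fun n => _) = cst 0); first exact: cvg_cst.
    apply/funext => n /=; suff -> : h n x = 0%R by rewrite mul0e.
    apply/le_anti/andP; split => //.
    have : (h n x)%:E <= g x; last by rewrite gx0 lee_fin.
    rewrite -(cvg_lim _ (hg x))//.
    apply: lime_ge; first by apply/cvg_ex; eexists; exact: hg.
    by exists n => // m; exact: ndh.
  apply: cvgeM; [|exact: hg|exact: cvg_cst].
  by apply: neq0_mule_def; rewrite mule_eq0 negb_or gx0.
- by move=> n; apply: emeasurable_funM => //; exact: mh.
- by move=> n x _; rewrite mule_ge0// lee_fin.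
- by move=> x _ m n mn; rewrite lee_wpmul2r// ndh.
Qed.

End density_integral.

(** * Measurability of the posterior variance *)

Section posterior_variance.
Context (R : realType) (dX : measure_display) (X : measurableType dX) (d : nat).
Variables (M : model R X d) (prior : probability (param R d) R) (n : nat).

(** Bayes' formula, together with the convention that the posterior is the prior
    where the predictive density is 0 or infinite. *)
Lemma ge0_integral_posterior (x : n.-tuple X) (f : param R d -> \bar R) :
  measurable_fun setT f -> (forall theta, 0 <= f theta) ->
  \int[posterior M prior x]_theta f theta =
  if (predictive_density M prior x == 0) ||
     (predictive_density M prior x == +oo)
  then \int[prior]_theta f theta
  else (fine (predictive_density M prior x))^-1%:E *
       \int[prior]_theta (f theta * likelihood M theta x).
Proof.
move=> mf f0; rewrite -(@ge0_integral_density_measure _ _ _ prior _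
  (measurable_likelihood_param M x) (fun t => likelihood_ge0 M t x))//.
case: ifPn => [bad|good].
  apply: eq_measure_integral => A mA _.
  by rewrite /= /posterior /= /mnormalize /= ifT.
have p0 : (0 <= (fine (predictive_density M prior x))^-1)%R.
  by rewrite invr_ge0 fine_ge0// predictive_density_ge0.
rewrite -[_%:E]/((NngNum p0)%:num%:E) -(ge0_integral_mscale _ measurableT)//.
apply: eq_measure_integral => A mA _.
by rewrite /= /posterior /mnormalize /= ifF ?(negbTE good)// /mscale/= muleC.
Qed.

Lemma measurable_integral_posterior (F : param R d * n.-tuple X -> \bar R) :
  measurable_fun setT F -> (forall z, 0 <= F z) ->
  measurable_fun setT
    (fun x => \int[posterior M prior x]_theta F (theta, x)).
Proof.
move=> mF F0; pose p := @predictive_density R dX X d M prior n.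
have mp : measurable_fun setT p.
  exact: (measurable_predictive_density M prior).
rewrite (_ : (fun x => _) = fun x => if (p x == 0) || (p x == +oo)
    then \int[prior]_theta F (theta, x)
    else (fine (p x))^-1%:E *
         \int[prior]_theta (F (theta, x) * likelihood M theta x)); last first.
  apply/funext => x; rewrite ge0_integral_posterior//.
  exact: measurableT_comp mF (pair2_measurable x).
apply: measurable_fun_if => //.
- by apply: measurable_or; apply: measurable_fun_eqe => //;
    exact: measurable_cst.
- by apply: measurable_funTS; exact: measurable_fun_fubini_tonelli_G.
- apply: emeasurable_funM; last first.
    apply: measurable_funTS.
    apply: (@measurable_fun_fubini_tonelli_G _ _ _ _ _ prior
      (fun z => F z * likelihood M z.1 z.2)).
      by apply: emeasurable_funM => //; exact: measurable_likelihood.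
    by move=> z; rewrite mule_ge0// likelihood_ge0.
  apply/measurable_EFinP; rewrite setTI.
  (* Inversion is continuous, hence measurable, away from 0. *)
  apply: (@measurable_comp _ _ _ _ _ _ [set r : R | r != 0%R]).
  + exact: open_measurable.
  + move=> /= _ [x /norP[s0 soo]] <-.
    by rewrite -eqe fineK// ge0_fin_numE ?ltey// predictive_density_ge0.
  + apply: open_continuous_measurable_fun => //; apply/in_setP => x /= x0.
    exact: inv_continuous.
  + by apply: measurableT_comp => //; exact: measurable_funTS.
Qed.

(** The posterior mean [e x] is itself a difference of posterior integrals,
    hence measurable, and [u2 x] is the posterior integral of the jointly
    measurable function [(theta0 theta - e x) ^+ 2]. *)
Lemma measurable_u2 : measurable_fun setT (@u2 R dX X d M prior n).
Proof.
pose post := @posterior R dX X d M prior n.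
pose e (x : n.-tuple X) := \int[post x]_theta (theta0 theta)%:E.
have mtheta0 : measurable_fun setT (EFin \o @theta0 R d).
  by apply/measurable_EFinP; exact: measurable_theta0.
have marginalE x (f : R -> \bar R) :
    measurable_fun setT f -> (forall y, 0 <= f y) ->
    \int[marginal_posterior M prior x]_y f y = \int[post x]_t f (theta0 t).
  by move=> mf f0; rewrite ge0_integral_distribution.
have eE x : 'E_(marginal_posterior M prior x)[idfun] = e x.
  rewrite unlock integralE [RHS]integralE.
  congr (_ - _); rewrite marginalE//.
  - by apply: eq_integral => t _; rewrite !funeposE.
  - by apply: measurable_funepos; apply/measurable_EFinP; exact: measurable_id.
  - by apply: eq_integral => t _; rewrite !funenegE.
  - by apply: measurable_funeneg; apply/measurable_EFinP; exact: measurable_id.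
have me : measurable_fun setT e.
  rewrite (_ : e = (fun x => \int[post x]_theta ((EFin \o @theta0 R d)^\+ theta)
    - \int[post x]_theta ((EFin \o @theta0 R d)^\- theta))); last first.
    by apply/funext => x; rewrite /e integralE.
  apply: emeasurable_funB.
    apply: (measurable_integral_posterior
      (F := fun z => (EFin \o @theta0 R d)^\+ z.1)) => //.
    exact: (measurableT_comp (measurable_funepos mtheta0) measurable_fst).
  apply: (measurable_integral_posterior
    (F := fun z => (EFin \o @theta0 R d)^\- z.1)) => //.
  exact: (measurableT_comp (measurable_funeneg mtheta0) measurable_fst).
rewrite (_ : @u2 R dX X d M prior n = fun x =>
  \int[post x]_theta ((theta0 theta - fine (e x)) ^+ 2)%:E); last first.
  apply/funext => x; rewrite /u2 /variance covariance.unlock eE.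
  rewrite expectation.unlock marginalE.
  - by apply: eq_integral => t _; rewrite -expr2.
  - apply/measurable_EFinP; apply: measurable_funM;
      by apply: measurable_funB; [exact: measurable_id|exact: measurable_cst].
  - by move=> y; rewrite lee_fin -expr2 sqr_ge0.
apply: (measurable_integral_posterior
  (F := fun z => ((theta0 z.1 - fine (e z.2)) ^+ 2)%:E)).
  apply/measurable_EFinP/measurable_funX/measurable_funB.
    by apply: measurableT_comp => //; exact: measurable_theta0.
  apply: measurableT_comp => //; exact: measurableT_comp.
by move=> z; rewrite lee_fin sqr_ge0.
Qed.

End posterior_variance.

(** * The joint law of parameter and data *)

Section joint_law.
Context (R : realType) (dX : measure_display) (X : measurableType dX) (d : nat).
Variables (M : model R X d) (prior : probability (param R d) R) (n : nat).

(** The law with density [likelihood] against the product of the prior and the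
    reference measure. Tonelli's theorem in one order exhibits the sampling
    measures and the prior marginal, in the other order the predictive one. The
    total mass is 1 because the prior does not charge the complement of the
    domain, where the likelihood vanishes. *)
Lemma joint_law : prior (domain M) = 1 ->
  exists Q : probability (param R d * n.-tuple X)%type R,
  [/\ forall F, measurable_fun setT F -> (forall z, 0 <= F z) ->
        \int[Q]_z F z =
        \int[prior]_theta \int[sampling M n theta]_x F (theta, x),
      forall f, measurable_fun setT f -> (forall theta, 0 <= f theta) ->
        \int[Q]_z f z.1 = \int[prior]_theta f theta &
      forall f, measurable_fun setT f -> (forall x, 0 <= f x) ->
        \int[Q]_z f z.2 = \int[predictive M prior n]_x f x].
Proof.
move=> prior_domain.
pose mlik := @measurable_likelihood R dX X d M n.
pose lik_ge0 := fun z : param R d * n.-tuple X => likelihood_ge0 M z.1 z.2.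
pose mu : {measure set (param R d * n.-tuple X)%type -> \bar R} :=
  density_measure (prior \x ref M n) mlik lik_ge0.
have muE F : measurable_fun setT F -> (forall z, 0 <= F z) ->
    \int[mu]_z F z = \int[prior]_theta \int[sampling M n theta]_x F (theta, x).
  move=> mF F0; rewrite ge0_integral_density_measure//.
  rewrite fubini_tonelli1//=; last 2 first.
  - exact: emeasurable_funM.
  - by move=> z; rewrite mule_ge0// lik_ge0.
  apply: eq_integral => theta _.
  rewrite /fubini_F ge0_integral_density_measure//.
  exact: measurableT_comp mF (pair1_measurable theta).
have sampling_cst (f : param R d -> \bar R) theta : 0 <= f theta ->
    \int[sampling M n theta]_x f theta = (f \_ (domain M)) theta.
  move=> f0; rewrite integral_cst// patchE.
  rewrite /sampling/= /Defs.density_measure /likelihood; case: ifPn => Dtheta.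
    by rewrite (density_normalized n (set_mem Dtheta)) mule1.
  by rewrite integral0 mule0.
have mu1E f : measurable_fun setT f -> (forall theta, 0 <= f theta) ->
    \int[mu]_z f z.1 = \int[prior]_theta f theta.
  move=> mf f0; rewrite (muE (f \o fst) (measurableT_comp mf measurable_fst)
    (fun z => f0 z.1)).
  under eq_integral do rewrite /= sampling_cst//.
  rewrite -integral_mkcond.
  have mD := measurable_domain M.
  rewrite [RHS](@ge0_negligible_integral _ _ _ _ _ (~` domain M))//.
  - by rewrite setTD setCK.
  - exact: measurableC.
  - have := probability_setC prior mD.
    by rewrite [X in _ - X]prior_domain subee.
have muT : mu setT = 1.
  have := mu1E (cst 1) (measurable_cst _) (fun=> lee01).
  by rewrite !integral_cst// !mul1e => ->; exact: probability_setT.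
pose Q : probability (param R d * n.-tuple X)%type R :=
  HB.pack (density_measure (prior \x ref M n) mlik lik_ge0)
    (Measure_isProbability.Build _ _ _ mu muT).
exists Q; split => //.
move=> f mf f0.
rewrite [LHS](@ge0_integral_density_measure _ _ _ _ _ _ _ (f \o snd)
  (measurableT_comp mf measurable_snd) (fun z => f0 z.2)).
rewrite fubini_tonelli2//=; last 2 first.
- by apply: emeasurable_funM => //; exact: measurableT_comp mf measurable_snd.
- by move=> z; rewrite mule_ge0// lik_ge0.
rewrite ge0_integral_density_measure//.
apply: eq_integral => x _; rewrite /fubini_G /= ge0_integralZl//.
- exact: measurable_likelihood_param.
- by move=> theta _; exact: likelihood_ge0.
Qed.
End joint_law.

(** * Mean and standard deviation under L2 perturbations *)

Lemma emeasurable_funX2 d (T : measurableType d) (R : realType)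
    (f : T -> \bar R) : measurable_fun setT f ->
  measurable_fun setT (fun x => f x ^+ 2).
Proof.
by move=> mf; under eq_fun do rewrite expe2; exact: emeasurable_funM.
Qed.

Section mean_and_deviation.
Context d (T : measurableType d) (R : realType) (P : probability T R).

Lemma Lfun2_sqr_lty (f : T -> R) : measurable_fun setT f ->
  \int[P]_x (f x ^+ 2)%:E < +oo -> f \in Lfun P 2%:E.
Proof.
move=> mf foo; rewrite inE/=; apply/andP; split; rewrite inE//=.
rewrite /finite_norm unlock poweR_lty//; apply: le_lt_trans foo.
rewrite le_eqVlt; apply/orP; left; apply/eqP; apply: eq_integral => x _ /=.
by rewrite powR_mulrn// real_normK// num_real.
Qed.

Definition sd (f : T -> R) : R := Num.sqrt (fine 'V_P[f]).

(** The covariance inequality makes the standard deviation a seminorm. *)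
Lemma sdD_le (X Y : T -> R) : X \in Lfun P 2%:E -> Y \in Lfun P 2%:E ->
  (sd (X \+ Y) <= sd X + sd Y)%R.
Proof.
move=> X2 Y2; rewrite /sd varianceD//.
have vX := variance_fin_num X2; have vY := variance_fin_num Y2.
have Pfin : P setT \is a fin_num := fin_num_measure P _ measurableT.
have cXY : covariance P X Y \is a fin_num.
  by rewrite covariance_fin_num ?Lfun2_mul_Lfun1// Lfun_subset12.
have := covariance_le X2 Y2.
have := variance_ge0 P X; have := variance_ge0 P Y.
rewrite -(fineK vX) -(fineK vY) -(fineK cXY) /= !lee_fin => vY0 vX0 cov_le.
rewrite -[leRHS]ger0_norm ?addr_ge0 ?sqrtr_ge0// -sqrtr_sqr ler_wsqrtr//.
rewrite sqrrD !sqr_sqrtr// mulr2n.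
by lra.
Qed.

Lemma sdN (X : T -> R) : X \in Lfun P 2%:E -> sd (\- X)%R = sd X.
Proof. by move=> X2; rewrite /sd varianceN. Qed.

(** The mean and the variance of [W] satisfy [(E W)^2 + V W = E (W^2)], so both
    [`|E W|] and [sd W] are bounded by the L2 norm of [W]. *)
Lemma mean_sd_L2_lipschitz (X W : T -> R) (D : R) : (0 <= D)%R ->
  X \in Lfun P 2%:E -> W \in Lfun P 2%:E ->
  \int[P]_x (W x ^+ 2)%:E <= (D ^+ 2)%:E ->
  (`|fine 'E_P[X \+ W]%R - fine 'E_P[X]| <= D /\
   `|sd (X \+ W) - sd X| <= D)%R.
Proof.
move=> D0 X2 W2 WD.
have Pfin : P setT \is a fin_num := fin_num_measure P _ measurableT.
have X1 := Lfun_subset12 Pfin X2; have W1 := Lfun_subset12 Pfin W2.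
have EW := expectation_fin_num W1; have EX := expectation_fin_num X1.
have vW := variance_fin_num W2.
have := varianceE W2; have := variance_ge0 P W.
have -> : 'E_P[W ^+ 2] = \int[P]_x (W x ^+ 2)%:E by rewrite expectation.unlock.
have : \int[P]_x (W x ^+ 2)%:E \is a fin_num.
  rewrite ge0_fin_numE ?(le_lt_trans WD) ?ltry//.
  by apply: integral_ge0 => x _; rewrite lee_fin sqr_ge0.
move: WD => /[swap] WD2.
rewrite -(fineK WD2) -(fineK vW) -(fineK EW) -EFin_expe -EFinB !lee_fin.
set v := fine 'V_P[W]; set m := fine 'E_P[W]; set D2 := fine (\int[P]_x _).
move=> D2D v0 [vE].
have m2 : (m ^+ 2 <= D ^+ 2)%R by lra.
have v2 : (v <= D ^+ 2)%R by have := sqr_ge0 m; lra.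
have sdW : (sd W <= D)%R.
  by rewrite /sd -[leRHS]ger0_norm// -sqrtr_sqr ler_wsqrtr.
split.
  rewrite expectationD// fineD// addrAC subrr add0r -/m.
  by rewrite -[leRHS]ger0_norm// -ler_sqr ?nnegrE// !real_normK// num_real.
have sd1 := sdD_le X2 W2.
have W2N : (\- W)%R \in Lfun P 2%:E by rewrite rpredN.
have XW2 : (X \+ W)%R \in Lfun P 2%:E by rewrite rpredD ?lee1n.
(* The other half of the Lipschitz bound writes [X] as [(X + W) + (- W)]. *)
have := sdD_le XW2 W2N; rewrite sdN//.
have -> : ((X \+ W) \+ (\- W))%R = X by apply/funext => x /=; rewrite addrK.
by move=> sd2; rewrite ler_norml; apply/andP; split; lra.
Qed.

(** Since its L2 distance to a real function is finite, [Y] is almost everywhere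
    finite, and [mean_sd_L2_lipschitz] applies to its finite part. *)
Lemma mean_sd_L2_stable (Y : T -> \bar R) (J : T -> R) (D : R) : (0 <= D)%R ->
  measurable_fun setT Y -> J \in Lfun P 2%:E ->
  \int[P]_x (`|Y x - (J x)%:E| ^+ 2) <= (D ^+ 2)%:E ->
  exists m s : R, [/\ \int[P]_x Y x = m%:E,
    sqrte (\int[P]_x ((Y x - m%:E) ^+ 2)) = s%:E,
    (`|m - fine 'E_P[J]| <= D)%R & (`|s - sd J| <= D)%R].
Proof.
move=> D0 mY J2 YJ.
have mJ : measurable_fun setT J by move: J2; rewrite inE => /andP[/[!inE]].
pose Z x := fine (Y x).
have mZ : measurable_fun setT Z by exact: measurableT_comp.
have mYJ : measurable_fun setT (fun x => `|Y x - (J x)%:E| ^+ 2).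
  apply: emeasurable_funX2; apply: measurableT_comp => //.
  by apply: emeasurable_funB => //; exact/measurable_EFinP.
have YZ : {ae P, forall x, setT x -> Y x = (Z x)%:E}.
  have : P.-integrable setT (fun x => `|Y x - (J x)%:E| ^+ 2).
    apply/integrableP; split => //.
    under eq_integral do rewrite gee0_abs ?sqre_ge0//.
    exact: le_lt_trans YJ (ltry _).
  move=> /integrable_ae => /(_ measurableT).
  apply: filterS => x /[swap] _ /(_ I).
  by rewrite /Z; case: (Y x) => //=; rewrite mulyy.
pose W := (Z \- J)%R.
have mW : measurable_fun setT W by exact: measurable_funB.
have WD : \int[P]_x (W x ^+ 2)%:E <= (D ^+ 2)%:E.
  apply: le_trans YJ; rewrite le_eqVlt; apply/orP; left; apply/eqP.
  apply: ae_eq_integral => //.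
  - by apply/measurable_EFinP; exact: measurable_funX.
  - apply: filterS YZ => x YZx xT; rewrite YZx// -EFinB abse_EFin -EFin_expe.
    by rewrite real_normK// num_real.
have W2 : W \in Lfun P 2%:E.
  by apply: Lfun2_sqr_lty => //; exact: le_lt_trans WD (ltry _).
have ZJW : Z = (J \+ W)%R by apply/funext => x; rewrite /W /= addrC subrK.
have [] := mean_sd_L2_lipschitz D0 J2 W2 WD; rewrite -ZJW => mD sD.
have Z2 : Z \in Lfun P 2%:E by rewrite ZJW rpredD ?lee1n.
have Pfin : P setT \is a fin_num := fin_num_measure P _ measurableT.
have EZ := expectation_fin_num (Lfun_subset12 Pfin Z2).
have EY : \int[P]_x Y x = (fine 'E_P[Z])%:E.
  rewrite fineK// expectation.unlock; apply: ae_eq_integral => //.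
  exact/measurable_EFinP.
exists (fine 'E_P[Z]), (sd Z); split => //.
rewrite /sd -[(Num.sqrt _)%:E]/(sqrte _%:E) (fineK (variance_fin_num Z2)).
rewrite /variance covariance.unlock; set m := fine 'E_P[Z].
congr sqrte; rewrite expectation.unlock.
apply: ae_eq_integral => //.
- by apply: emeasurable_funX2; exact: emeasurable_funB.
- apply/measurable_EFinP; apply: measurable_funM; exact: measurable_funB.
- by apply: filterS YZ => x YZx xT; rewrite YZx// -EFinB -EFin_expe expr2.
Qed.

End mean_and_deviation.

(** * Rescaled mean and deviation of the posterior variance *)

(** A coupling [Q] of [P1] and [P2] transfers the L2 stability of mean and
    deviation from two functions on one space to functions of the two
    marginals. *)
Lemma coupling_mean_sd d1 d2 (T1 : measurableType d1) (T2 : measurableType d2)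
    (R : realType) (Q : probability (T1 * T2)%type R) (P1 : probability T1 R)
    (P2 : {measure set T2 -> \bar R}) (J : T1 -> R) (U : T2 -> \bar R)
    (c D : R) :
  (forall f, measurable_fun setT f -> (forall x, 0 <= f x) ->
     \int[Q]_z f z.1 = \int[P1]_x f x) ->
  (forall f, measurable_fun setT f -> (forall x, 0 <= f x) ->
     \int[Q]_z f z.2 = \int[P2]_x f x) ->
  measurable_fun setT J -> (forall x, 0 <= J x)%R -> 'E_P1[J ^+ 2] < +oo ->
  measurable_fun setT U -> (forall x, 0 <= U x) -> (0 < c)%R -> (0 <= D)%R ->
  \int[Q]_z (`|c%:E * U z.2 - (J z.1)%:E| ^+ 2) <= (D ^+ 2)%:E ->
  exists m s : R, [/\ c%:E * \int[P2]_x U x = m%:E,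
    c%:E * sqrte (\int[P2]_x ((U x - \int[P2]_x U x) ^+ 2)) = s%:E,
    (`|m - fine 'E_P1[J]| <= D)%R & (`|s - sd P1 J| <= D)%R].
Proof.
move=> Q1 Q2 mJ J0 J2oo mU U0 c0 D0 QD.
have cE : 0 <= c%:E by rewrite lee_fin ltW.
have mcU : measurable_fun setT (fun x => c%:E * U x) by exact: measurable_funeM.
pose Y (z : T1 * T2) := c%:E * U z.2.
have mY : measurable_fun setT Y by exact: (measurableT_comp mcU measurable_snd).
have mJQ : measurable_fun setT (J \o fst : T1 * T2 -> R).
  exact: (measurableT_comp mJ measurable_fst).
have JQ2 : J \o fst \in Lfun Q 2%:E.
  apply: Lfun2_sqr_lty => //.
  have := Q1 (fun x => (J x ^+ 2)%:E); rewrite /= => ->.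
  - by move: J2oo; rewrite expectation.unlock.
  - by apply/measurable_EFinP; exact: measurable_funX.
  - by move=> x; rewrite lee_fin sqr_ge0.
have EJ : 'E_Q[J \o fst] = 'E_P1[J].
  rewrite expectation.unlock; apply: (Q1 (EFin \o J)).
    exact/measurable_EFinP.
  by move=> x; rewrite lee_fin.
have sdJ : sd Q (J \o fst) = sd P1 J.
  rewrite /sd /variance covariance.unlock EJ; set e := fine 'E_P1[J].
  rewrite expectation.unlock; congr (Num.sqrt (fine _)).
  pose f x : \bar R := ((J x - e) * (J x - e))%:E.
  have mf : measurable_fun setT f.
    by apply/measurable_EFinP; apply: measurable_funM; exact: measurable_funB.
  have f0 x : 0 <= f x by rewrite lee_fin -expr2 sqr_ge0.
  exact: (Q1 f mf f0).
have [m [s [mE sE mD sD]]] := mean_sd_L2_stable D0 mY JQ2 QD.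
have meanE : c%:E * \int[P2]_x U x = m%:E.
  rewrite -mE (Q2 (fun x => c%:E * U x))//.
    by rewrite ge0_integralZl.
  by move=> x; rewrite mule_ge0.
have mean_fin : \int[P2]_x U x = (m / c)%:E.
  by rewrite EFinM muleC -meanE muleA -EFinM mulVf ?mul1e// gt_eqF.
exists m, s; split=> //; last 2 first.
- by rewrite -EJ.
- by rewrite -sdJ.
rewrite -sE (Q2 (fun x => (c%:E * U x - m%:E) ^+ 2)); last 2 first.
- by apply: emeasurable_funX2; exact: emeasurable_funB.
- by move=> x; exact: sqre_ge0.
have sqE x : (c%:E * U x - m%:E) ^+ 2 =
    c%:E ^+ 2 * (U x - \int[P2]_x U x) ^+ 2.
  by rewrite -meanE -muleBr// ?mean_fin ?fin_num_adde_defl// !expe2 muleACA.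
under [in RHS]eq_integral do rewrite sqE.
rewrite ge0_integralZl//.
- by rewrite sqrteM ?sqre_ge0// sqrte_sqr gee0_abs.
- by apply: emeasurable_funX2; rewrite mean_fin; exact: emeasurable_funB.
- by move=> x _; exact: sqre_ge0.
- exact: sqre_ge0.
Qed.

Lemma u2_ge0 (R : realType) (dX : measure_display) (X : measurableType dX)
    (d : nat) (M : model R X d) (prior : probability (param R d) R) n
    (x : n.-tuple X) : 0 <= u2 M prior x.
Proof. exact: variance_ge0. Qed.

Lemma inv_fisher0_ge0 (R : realType) (dX : measure_display)
    (X : measurableType dX) (d : nat) (M : model R X d) theta :
  (0 <= inv_fisher0 M theta)%R.
Proof.
rewrite /inv_fisher0 patchE; case: ifPn => // _; rewrite invr_ge0.
rewrite /fisher0 /fisher mxE /Rintegral fine_ge0// integral_ge0// => x _.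
by rewrite lee_fin -expr2 sqr_ge0.
Qed.

Section scaled_mean_and_deviation.
Context (R : realType) (dX : measure_display) (X : measurableType dX) (d : nat).
Variables (M : model R X d) (prior : probability (param R d) R).
Local Notation J := (inv_fisher0 M).

(** With [joint_law] as the coupling, the L2 distance is the quantity that
    Assumption A sends to 0. *)
Lemma scaled_mean_sd_u2 (n : nat) (D : R) : prior (domain M) = 1 ->
  measurable_fun setT J -> 'E_prior[J ^+ 2] < +oo -> (0 < n)%N -> (0 <= D)%R ->
  \int[prior]_theta \int[sampling M n theta]_x
    (`|n%:R%:E * u2 M prior x - (J theta)%:E| ^+ 2) <= (D ^+ 2)%:E ->
  exists m s : R, [/\ n%:R%:E * mean_u2 M prior n = m%:E,
    n%:R%:E * sd_u2 M prior n = s%:E,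
    (`|m - fine 'E_prior[J]| <= D)%R & (`|s - sd prior J| <= D)%R].
Proof.
move=> prior_domain mJ J2oo n0 D0 WD.
have [Q [QE Q1 Q2]] := joint_law n prior_domain.
have mU := @measurable_u2 R dX X d M prior n.
have n0R : (0 < n%:R :> R)%R by rewrite ltr0n.
apply: (coupling_mean_sd Q1 Q2 mJ (inv_fisher0_ge0 M) J2oo mU
  (@u2_ge0 _ _ _ _ M prior n) n0R D0).
pose F (z : param R d * n.-tuple X) :=
  `|n%:R%:E * u2 M prior z.2 - (J z.1)%:E| ^+ 2.
have mF : measurable_fun setT F.
  apply: (@emeasurable_funX2 _ _ _
    (fun z : param R d * n.-tuple X =>
       `|n%:R%:E * u2 M prior z.2 - (J z.1)%:E|)).
  apply: measurableT_comp; first exact: abse_measurable.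
  apply: emeasurable_funB.
    by apply: measurable_funeM; exact: (measurableT_comp mU measurable_snd).
  apply: measurableT_comp; first exact: EFin_measurable.
  exact: (measurableT_comp mJ measurable_fst).
have F0 z : 0 <= F z by exact: sqre_ge0.
by rewrite (QE F mF F0).
Qed.

End scaled_mean_and_deviation.

(** * Asymptotics of the threshold *)

Lemma cvge0_near_le (R : realType) (u : nat -> \bar R) (e : R) :
  u n @[n --> \oo] --> 0 -> (0 < e)%R -> \forall n \near \oo, u n <= e%:E.
Proof.
move=> u0 e0.
have : nbhs (0 : \bar R) [set x | x < e%:E].
  apply: open_nbhs_nbhs; split; first exact: open_ereal_lt_ereal.
  by rewrite /= lte_fin.
by move=> /u0[N _ uN]; exists N => // n Nn; exact/ltW/uN.
Qed.

(** Chebyshev: L2 convergence to a constant excludes, in probability, every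
    event forcing a deviation of at least [delta]. *)
Lemma cvg0_deviation d (T : nat -> measurableType d) (R : realType)
    (P : forall n, {measure set (T n) -> \bar R}) (V : forall n, T n -> \bar R)
    (c delta : R) (E : forall n, set (T n)) :
  (forall n, measurable_fun setT (V n)) -> (forall n, measurable (E n)) ->
  (0 < delta)%R ->
  \int[P n]_x (`|V n x - c%:E| ^+ 2) @[n --> \oo] --> 0 ->
  (\forall n \near \oo, E n `<=` [set x | delta%:E <= `|V n x - c%:E|]) ->
  P n (E n) @[n --> \oo] --> 0.
Proof.
move=> mV mE delta0 V0 EV.
pose I n := \int[P n]_x (`|V n x - c%:E| ^+ 2).
apply: (@squeeze_cvge _ _ _ _ (cst 0) _ (fun n => (delta ^- 2)%:E * I n)).
- apply: filterS EV => n EVn; rewrite measure_ge0/=.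
  have mVc : measurable_fun setT (fun x => V n x - c%:E).
    by apply: emeasurable_funB => //; exact: measurable_cst.
  have mD : measurable [set x | delta%:E <= `|V n x - c%:E|].
    rewrite -[X in measurable X]setTI; apply: emeasurable_fun_c_infty => //.
    exact: measurableT_comp.
  apply: (@le_trans _ _ (P n [set x | delta%:E <= `|V n x - c%:E|])).
    by apply: le_measure => //; rewrite inE.
  rewrite lee_pdivlMl ?exprn_gt0//.
  have := @le_integral_comp_abse _ _ _ (P n) _ measurableT
    (fun x => V n x - c%:E) delta (fun x => x ^+ 2).
  rewrite setTI -EFin_expe; apply => //.
  + exact: emeasurable_funX2.
  + by move=> r _; exact: sqre_ge0.
  + move=> x y /[!inE]/=; rewrite !in_itv/= !andbT => x0 y0 xy.
    by rewrite lee_sqr.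
- exact: cvg_cst.
- by rewrite -(mule0 (delta ^- 2)%:E); exact: cvgeZl.
Qed.

Section threshold_asymptotics.
Context (R : realType) (dX : measure_display) (X : measurableType dX) (d : nat).
Variables (M : model R X d) (prior : probability (param R d) R).
Local Notation J := (inv_fisher0 M).
Hypothesis prior_domain : prior (domain M) = 1.
Hypothesis mJ : measurable_fun setT J.
Hypothesis J2oo : 'E_prior[J ^+ 2] < +oo.
Hypothesis cvg_prior :
  \int[prior]_theta \int[sampling M n theta]_x
    (`|n%:R%:E * u2 M prior x - (J theta)%:E| ^+ 2) @[n --> \oo] --> 0.

(** The thresholds may be infinite for small [n], so convergence of [n] times
    the threshold to [mu + k sigma] is put as eventual finiteness with a bound on
    the error. *)
Lemma near_scaled_threshold (k e : R) : (0 < e)%R ->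
  \forall n \near \oo, exists2 t : R,
    n%:R%:E * threshold M prior k n = t%:E &
    (`|t - (fine 'E_prior[J] + k * sd prior J)| <= e)%R.
Proof.
move=> e0.
(* An L2 distance [D] moves [m + k s] by at most [D + `|k| D = e]. *)
pose D : R := (e / (1 + `|k|))%R.
have k1 : (0 < 1 + `|k|)%R by rewrite ltr_pwDl.
have D0 : (0 < D)%R by rewrite divr_gt0.
have D20 : (0 < D ^+ 2)%R by rewrite exprn_gt0.
have := cvge0_near_le cvg_prior D20.
move=> near_D; near=> n.
have n0 : (0 < n)%N by near: n; exact: nbhs_infty_gt.
have nD : \int[prior]_theta \int[sampling M n theta]_x
    (`|n%:R%:E * u2 M prior x - (J theta)%:E| ^+ 2) <= (D ^+ 2)%:E by near: n.
have [m [s [mE sE mD sD]]] :=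
  scaled_mean_sd_u2 prior_domain mJ J2oo n0 (ltW D0) nD.
have n_gt0 : 0 < n%:R%:E :> \bar R by rewrite lte_fin ltr0n.
exists (m + k * s)%R.
  have sd_fin : sd_u2 M prior n = (s / n%:R)%:E.
    by rewrite EFinM muleC -sE muleA -EFinM mulVf ?mul1e// pnatr_eq0 -lt0n.
  rewrite /threshold muleDr//; last by rewrite sd_fin fin_num_adde_defl.
  by rewrite mE muleCA sE.
rewrite opprD addrACA -mulrBr (le_trans (ler_normD _ _))// normrM.
have -> : e = (D + `|k| * D)%R.
  by rewrite -[X in (X + _)%R]mul1r -mulrDl /D mulrC divfK// gt_eqF.
by rewrite lerD// ler_wpM2l.
Unshelve. all: by end_near.
Qed.

Lemma near_threshold_lt (k e : R) : (0 < e)%R ->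
  \forall n \near \oo, threshold M prior k n < e%:E.
Proof.
move=> e0; pose tau : R := (fine 'E_prior[J] + k * sd prior J)%R.
have near_tau := near_scaled_threshold k (@ltr01 R).
near=> n.
have n0 : (0 < n%:R :> R)%R by rewrite ltr0n; near: n; exact: nbhs_infty_gt.
have [t tE] : exists2 t : R, n%:R%:E * threshold M prior k n = t%:E &
    (`|t - tau| <= 1)%R by near: n.
move=> /ler_normlP[_ t1].
have ne : ((tau + 1) / e < n%:R)%R by near: n; exact: nbhs_infty_gtr.
rewrite -(@lte_pmul2l _ n%:R%:E) ?lte_fin// tE -EFinM lte_fin.
by move: ne; rewrite ltr_pdivrMr//; lra.
Unshelve. all: by end_near.
Qed.

Variables (theta_true : param R d) (c : R).
Hypothesis cvg_true :
  \int[sampling M n theta_true]_x (`|n%:R%:E * u2 M prior x - c%:E| ^+ 2)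
    @[n --> \oo] --> 0.

Let measurable_scaled_u2 n :
  measurable_fun setT (fun x : n.-tuple X => n%:R%:E * u2 M prior x).
Proof. by apply: measurable_funeM; exact: measurable_u2. Qed.

Lemma cvg_sampling_threshold_lt (k : R) :
  (c < fine 'E_prior[J] + k * sd prior J)%R ->
  sampling M n theta_true [set x | threshold M prior k n < u2 M prior x]
    @[n --> \oo] --> 0.
Proof.
set tau := (fine _ + _)%R => ctau; pose delta : R := ((tau - c) / 2)%R.
have delta0 : (0 < delta)%R by rewrite divr_gt0// subr_gt0.
apply: (cvg0_deviation measurable_scaled_u2 _ delta0 cvg_true).
  move=> n; rewrite -[X in measurable X]setTI.
  by apply: emeasurable_fun_o_infty => //; exact: measurable_u2.
have near_tau := near_scaled_threshold k delta0.
near=> n => x /= thr_u2.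
have n0 : (0 < n%:R :> R)%R by rewrite ltr0n; near: n; exact: nbhs_infty_gt.
have [t tE] : exists2 t : R, n%:R%:E * threshold M prior k n = t%:E &
    (`|t - tau| <= delta)%R by near: n.
move=> /ler_normlP[t1 _].
move: thr_u2; rewrite -(@lte_pmul2l _ n%:R%:E) ?lte_fin// tE => t_u2.
case: (_ * _) t_u2 => [r| |]; rewrite ?leey// lte_fin => tr.
rewrite -EFinB abse_EFin lee_fin; apply: le_trans (ler_norm _).
by move: t1; rewrite /delta; lra.
Unshelve. all: by end_near.
Qed.

Lemma cvg_sampling_lt_threshold (k : R) :
  (fine 'E_prior[J] + k * sd prior J < c)%R ->
  sampling M n theta_true [set x | u2 M prior x < threshold M prior k n]
    @[n --> \oo] --> 0.
Proof.
set tau := (fine _ + _)%R => tauc; pose delta : R := ((c - tau) / 2)%R.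
have delta0 : (0 < delta)%R by rewrite divr_gt0// subr_gt0.
apply: (cvg0_deviation measurable_scaled_u2 _ delta0 cvg_true).
  move=> n; rewrite -[X in measurable X]setTI.
  by apply: emeasurable_fun_infty_o => //; exact: measurable_u2.
have near_tau := near_scaled_threshold k delta0.
near=> n => x /= u2_thr.
have n0 : (0 < n%:R :> R)%R by rewrite ltr0n; near: n; exact: nbhs_infty_gt.
have [t tE] : exists2 t : R, n%:R%:E * threshold M prior k n = t%:E &
    (`|t - tau| <= delta)%R by near: n.
move=> /ler_normlP[_ t1].
move: u2_thr; rewrite -(@lte_pmul2l _ n%:R%:E) ?lte_fin// tE => u2_t.
case: (_ * _) u2_t => [r| |] => [|//|]; rewrite ?leey// lte_fin => rt.
rewrite -EFinB abse_EFin lee_fin distrC; apply: le_trans (ler_norm _).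
by move: t1; rewrite /delta; lra.
Unshelve. all: by end_near.
Qed.

End threshold_asymptotics.

(** * The smallest sample size reaching a precision *)

Section stopping_index.
Context (R : realType) (dX : measure_display) (X : measurableType dX) (d : nat).
Variables (M : model R X d) (prior : probability (param R d) R) (k : R).
Local Notation thr := (threshold M prior k).
Hypothesis thr_small : forall e : R, (0 < e)%R ->
  \forall n \near \oo, thr n < e%:E.
Hypothesis thr_gt0 : forall n, (1 <= n)%N -> 0 < thr n.

Lemma exists_n_eps (eps : R) : (0 < eps)%R ->
  exists n, is_n_eps M prior k eps n.
Proof.
move=> eps0; have e2 : (0 < eps ^+ 2)%R by rewrite exprn_gt0.
have [N _ thrN] := thr_small e2.
have exN : exists n, (1 <= n)%N && (thr n < (eps ^+ 2)%:E).
  by exists N.+1; rewrite thrN//=.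
case: (ex_minnP exN) => n /andP[n1 nthr] n_min; exists n; split => // m m1 mthr.
by apply: n_min; rewrite m1.
Qed.

Lemma n_epsP (eps : R) : (0 < eps)%R ->
  is_n_eps M prior k eps (n_eps M prior k eps).
Proof. by move=> /exists_n_eps[n]; exact: xgetI. Qed.

(** Finitely many positive thresholds are bounded away from 0, so none of the
    first [N] is below [eps ^+ 2] when [eps] is small. *)
Lemma cvg_n_eps : n_eps M prior k eps @[eps --> 0^'+] --> \oo.
Proof.
move=> A [N _ NA]; apply: (@filterS _ (nbhs 0^'+) _
  [set eps : R | (N <= n_eps M prior k eps)%N]); first by move=> eps; exact: NA.
have : \forall eps \near (0 : R)^'+, forall m, (1 <= m)%N -> (m < N)%N ->
    (eps ^+ 2)%:E <= thr m.
  elim: N {NA} => [|N IH]; first exact: nearW.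
  have [N0|N1] := posnP N.
    by apply: nearW => eps m m1; rewrite N0 ltnS leqNgt m1.
  have [r r0 rN] : exists2 r : R, (0 < r)%R & r%:E <= thr N.
    have := thr_gt0 N1; case: (thr N) => [r| |]// r0.
      by exists r.
    (* An infinite threshold is above any real number. *)
    by exists 1%R; rewrite ?leey.
  near=> eps => m m1; rewrite ltnS leq_eqVlt => /predU1P[->|mN].
    apply: le_trans rN; rewrite lee_fin.
    have e0 : (0 < eps)%R by near: eps; exact: nbhs_right_gt.
    have e1 : (eps <= 1)%R by near: eps; apply: nbhs_right_le.
    have er : (eps <= r)%R by near: eps; apply: nbhs_right_le.
    by apply: le_trans er; rewrite expr2 ler_piMl// ltW.
  by move: m m1 mN; near: eps.
move=> near_thr; near=> eps.
have e0 : (0 < eps)%R by near: eps; exact: nbhs_right_gt.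
have [n1 nthr _] := n_epsP e0.
have thrE : forall m, (1 <= m)%N -> (m < N)%N -> (eps ^+ 2)%:E <= thr m.
  by near: eps.
rewrite /= leqNgt; apply/negP => nN.
by have := thrE _ n1 nN; rewrite leNgt nthr.
Unshelve. all: by end_near.
Qed.

End stopping_index.

(** * Posterior precision under the true parameter *)

Theorem theorem3p5 (R : realType) (dX : measure_display)
    (X : measurableType dX) (d : nat) (M : model R X d)
    (prior : probability (param R d) R) (theta_true : param R d)
    (prior_domain : prior (domain M) = 1)
    (domain_theta_true : domain M theta_true)
    (A : assumption_A M prior theta_true) :
  [/\ forall k : R, (k_star M prior theta_true < k)%R ->
        sampling M n theta_true [set x | threshold M prior k n < u2 M prior x]
          @[n --> \oo] --> 0,
      forall k : R, (k_star M prior theta_true < k)%R ->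
        (forall eps : R, (0 < eps)%R ->
           exists n : nat, is_n_eps M prior k eps n) /\
        (sampling M (n_eps M prior k eps) theta_true
           [set x | (eps ^+ 2)%:E <= u2 M prior x]
           @[eps --> 0^'+] --> 0) &
      forall k : R, (0 < k)%R -> (k < k_star M prior theta_true)%R ->
        sampling M n theta_true [set x | u2 M prior x < threshold M prior k n]
          @[n --> \oo] --> 0].
Proof.
case: A => _ _ mJ J2oo varJ cvg_true cvg_prior mean_gt0.
set c := (_^-1)%R in cvg_true.
have J2 : inv_fisher0 M \in Lfun prior 2%:E.
  by apply: Lfun2_sqr_lty => //; move: J2oo; rewrite expectation.unlock.
have sdJ : (0 < sd prior (inv_fisher0 M))%R.
  by rewrite sqrtr_gt0 fine_gt0// varJ ltey_eq variance_fin_num.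
have k_starE : (k_star M prior theta_true * sd prior (inv_fisher0 M) =
    Num.max (c - fine 'E_prior[inv_fisher0 M]) 0)%R.
  by rewrite /k_star divfK// gt_eqF.
have k_star_ge0 : (0 <= k_star M prior theta_true)%R.
  by rewrite divr_ge0 ?sqrtr_ge0// le_max lexx orbT.
have k_star_lt k : (k_star M prior theta_true < k)%R ->
    (c < fine 'E_prior[inv_fisher0 M] + k * sd prior (inv_fisher0 M))%R.
  rewrite -(ltr_pM2r sdJ) k_starE gt_max => /andP[+ _].
  by rewrite ltrBlDl.
have part1 k : (k_star M prior theta_true < k)%R ->
    sampling M n theta_true [set x | threshold M prior k n < u2 M prior x]
      @[n --> \oo] --> 0.
  move=> /k_star_lt.
  exact: (cvg_sampling_threshold_lt prior_domain mJ J2oo cvg_prior cvg_true).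
split => // [k kk|k k0 kk].
- have thr_small := near_threshold_lt prior_domain mJ J2oo cvg_prior k.
  have thr_gt0 n : (1 <= n)%N -> 0 < threshold M prior k n.
    move=> n1; rewrite /threshold lte_paddr ?mean_gt0// mule_ge0 ?sqrte_ge0//.
    by rewrite lee_fin (le_trans k_star_ge0)// ltW.
  split; first by move=> eps; exact: exists_n_eps.
  have := cvg_comp _ _ (cvg_n_eps thr_small thr_gt0) (part1 k kk).
  apply: (@squeeze_cvge _ _ _ _ (cst 0)); last 1 first; [exact: cvg_cst|].
  near=> eps; rewrite measure_ge0/=.
  have e0 : (0 < eps)%R by near: eps; exact: nbhs_right_gt.
  have [_ nthr _] := n_epsP thr_small e0.
  apply: le_measure; rewrite ?inE.
  + rewrite -[X in measurable X]setTI.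
    by apply: emeasurable_fun_c_infty => //; exact: measurable_u2.
  + rewrite -[X in measurable X]setTI.
    by apply: emeasurable_fun_o_infty => //; exact: measurable_u2.
  + by move=> x /=; exact: lt_le_trans.
- apply: (cvg_sampling_lt_threshold prior_domain mJ J2oo cvg_prior cvg_true).
  move: kk; rewrite -(ltr_pM2r sdJ) k_starE lt_max.
  by rewrite (ltNge _ 0%R) mulr_ge0 ?ltW// orbF ltrBrDl.
Unshelve. all: by end_near.
Qed.
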